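(* Let $\tau_N$ denote the first time the single-well random walk with parameter $\theta$, started at $0$, hits the target set $\{-N,N\}$. Then: (i) for any $0<\theta<1/2$, $\dfrac{\tau_N}{\mathbb E_{0,\delta_\theta}[\tau_N]}$ converges in distribution (under $\mathbb P_{0,\delta_\theta}$), as $N\to\infty$, to an exponential random variable with parameter $1$; (ii) for any $1/2<\theta\le1$, $$\frac{\tau_N}{\mathbb E_{0,\delta_\theta}[\tau_N]}\underset{N\to\infty}{\longrightarrow}1\qquad \mathbb P_{0,\delta_\theta}\text{-almost surely}.$$
   Context: Single-well random walk with parameter $\theta\in[0,1]$: the nearest-neighbour Markov chain with transition probabilities $Q^{(\theta)}(x,x+1)=\theta$, $Q^{(\theta)}(x,x-1)=1-\theta$ for $x\ge1$, and $Q^{(\theta)}(x,x+1)=1-\theta$, $Q^{(\theta)}(x,x-1)=\theta$ for $x\le0$. For each $N\ge1$ the walk is considered on $\{-N,\dots,N\}$ until it hits $\{-N,N\}$; the transition rule does not depend on $N$, and all the times $\tau_N$, $N\ge1$, are hitting times of one and the same walk on $\mathbb Z$. $\mathbb P_{0,\delta_\theta}$ and $\mathbb E_{0,\delta_\theta}$ denote probability and expectation for the walk with parameter $\theta$ started at $0$. *)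

(* Defs.v *)
From HB Require Import structures.
From mathcomp Require Import all_boot all_order all_algebra.
From mathcomp Require Import all_classical all_reals all_analysis.
Set Implicit Arguments.
Unset Strict Implicit.
Unset Printing Implicit Defensive.
Import Order.TTheory GRing.Theory Num.Theory.
Import numFieldNormedType.Exports.
Local Open Scope classical_set_scope.
Local Open Scope ring_scope.
Local Open Scope ereal_scope.

(* The transition probability Q^(theta)(x, y); theta is the probability of
   stepping right from x >= 1, and of stepping left from x <= 0. *)
Definition single_well {R : realType} (theta : R) (x y : int) : R :=
  (if 1 <= x then
     if y == x + 1 then theta else if y == x - 1 then 1 - theta else 0
   else
     if y == x + 1 then 1 - theta else if y == x - 1 then theta else 0)%R.

(* On a countable state space, the Markov property conditioned on the whole
   past, in product form so that conditioning events of probability 0 need no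
   convention; measurability is for the discrete sigma-algebra on S. *)
Definition markov_chain {d : measure_display} {T : measurableType d}
    {R : realType} (P : probability T R) {S : countType} (Q : S -> S -> R)
    (x0 : S) (X : nat -> T -> S) : Prop :=
  [/\ forall n x, measurable [set w | X n w = x],
      P [set w | X 0%N w = x0] = 1 &
      forall (n : nat) (s : nat -> S),
        P [set w | forall i, (i <= n.+1)%N -> X i w = s i] =
        P [set w | forall i, (i <= n)%N -> X i w = s i]
          * (Q (s n) (s n.+1))%:E].

(* The value is +oo on trajectories that never visit A. *)
Definition hitting_time {R : realType} {T S : Type} (X : nat -> T -> S)
    (A : set S) (w : T) : \bar R :=
  ereal_inf [set (n%:R)%:E | n in [set n : nat | A (X n w)]].

Definition tau {R : realType} {T : Type} (X : nat -> T -> int) (N : nat)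
    (w : T) : \bar R :=
  hitting_time X [set (- N%:Z)%R; N%:Z] w.

(* Extended-real division: x / +oo = 0, so neither convergence to Exp(1) nor
   to 1 can hold spuriously because of an infinite expectation. *)
Definition normalized_tau {d : measure_display} {T : measurableType d}
    {R : realType} (P : probability T R) (X : nat -> T -> int) (N : nat)
    (w : T) : \bar R :=
  tau X N w / \int[P]_v tau X N v.

(* Pointwise convergence of distribution functions at the continuity points of
   the limit; the Y n may take infinite values, the limit law mu lives on R. *)
Definition cvg_in_distribution {d : measure_display} {T : measurableType d}
    {R : realType} (P : probability T R) (Y : nat -> T -> \bar R)
    (mu : set R -> \bar R) : Prop :=
  forall t : R, {for t, continuous (fun u : R => mu `]-oo, u]%classic)} ->
    P [set w | Y n w <= t%:E] @[n --> \oo] --> mu `]-oo, t]%classic.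

(* Main.v *)
Require Import Defs.
From HB Require Import structures.
From mathcomp Require Import all_boot all_order all_algebra.
From mathcomp Require Import all_classical all_reals all_analysis.
From mathcomp Require Import measurable_realfun.
From mathcomp Require Import zify ring lra.
Import Order.TTheory GRing.Theory Num.Theory.
Import numFieldNormedType.Exports.
Local Open Scope classical_set_scope.
Local Open Scope ring_scope.

Set Implicit Arguments.
Unset Strict Implicit.

(** The distance to [0] of the single-well walk is a walk on [nat] reflected
    at [0], which moves outwards with probability [theta], and [tau_N] is its
    hitting time of [N]. Let [V(k)] be the mean time needed to reach [k] from
    [0]: one step raises [V] of the distance by exactly [1] in the mean
    ([radial_step_mean_hitting]), so that E(tau_N) = V(N)
    ([expectation_tau]).

    For [theta < 1/2], let G(n) = P(tau_N > n) and let H(n) be the mean of the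
    remaining time (tau_N - n)^+, which is the mean of V(N) - V(distance at
    time n) on {tau_N > n}. Then H(n+1) = H(n) - G(n) ([residualS]). Since [V]
    grows geometrically while the inward drift keeps an exponential moment of
    the distance bounded, V(distance) is negligible with respect to V(N), and
    H(n) / V(N) differs from G(n) by at most a geometrically small [eps_N]
    ([survival_residual]). Thus F = H / V(N) almost solves the recursion
    F(n+1) = (1 - 1/V(N)) F(n), uniformly on the time scale V(N), which gives
    P(tau_N > t V(N)) --> exp(-t) ([decay_floor], [survival_decay]).

    For [theta > 1/2], the fourth centred moment of the distance at time [n]
    is O(n^2) ([fourth_moment]), so the distance divided by [n] tends almost
    surely to 2 theta - 1 ([ae_distance_speed]). At time [tau_N] the distance
    is [N], so N / tau_N has the same limit ([cvg_along_hitting_times]), and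
    V(N) / N tends to its inverse ([cvg_mean_hitting]).

    Probabilities are reduced to finite sums: the positions up to time [n]
    almost surely form one of the finitely many nearest-neighbour histories of
    [n] steps, and the Markov property gives the weight of each
    ([expectation_history]). *)

(** * Finite histories of the walk *)

Section Histories.
Context {R : realType} (theta : R).
Implicit Types (h : seq int) (F G : seq int -> R).

(** A history lists the visited sites from the present backwards, so that the
    current position is its head and one more step is one more [cons]. *)
Fixpoint histories (n : nat) : seq (seq int) :=
  if n is n'.+1 then
    [seq head 0 h + e :: h | h <- histories n', e <- [:: 1; -1]]
  else [:: [:: 0]].

Definition distance h : nat := absz (head 0 h).

Fixpoint weight h : R :=
  if h is y :: h' then
    if h' is x :: _ then weight h' * single_well theta x y else 1
  else 1.

Arguments weight : simpl never.

Definition path_mean n F : R := \sum_(h <- histories n) weight h * F h.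

Definition step_mean F h : R :=
  single_well theta (head 0 h) (head 0 h + 1) * F (head 0 h + 1 :: h) +
  single_well theta (head 0 h) (head 0 h - 1) * F (head 0 h - 1 :: h).

Lemma uniq_histories n : uniq (histories n).
Proof.
elim: n => [//|n IH]; rewrite /histories -/histories.
apply: allpairs_uniq => //.
move=> [h e] [h' e'] /= _ _ [+ hh']; rewrite hh' => /addrI ->; congr (_, _).
Qed.

Lemma size_histories n h : h \in histories n -> size h = n.+1.
Proof.
elim: n h => [h|n IH h]; first by rewrite inE => /eqP ->.
by move=> /allpairsP[[h' e] /= [/IH sh' _ ->]] /=; rewrite sh'.
Qed.

Lemma weight_cons y h : h != [::] ->
  weight (y :: h) = weight h * single_well theta (head 0 h) y.
Proof. by case: h. Qed.

Lemma path_mean0 F : path_mean 0 F = F [:: 0].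
Proof. by rewrite /path_mean big_seq1 mul1r. Qed.

Lemma path_meanS n F : path_mean n.+1 F = path_mean n (step_mean F).
Proof.
rewrite /path_mean big_allpairs_dep /= big_seq [RHS]big_seq.
apply: eq_bigr => h /size_histories sh.
have h0 : h != [::] by case: h sh.
rewrite big_cons big_seq1 !weight_cons //=.
by rewrite /step_mean mulrDr !mulrA.
Qed.

Lemma eq_path_mean n F G :
  (forall h, h \in histories n -> F h = G h) -> path_mean n F = path_mean n G.
Proof.
move=> FG; rewrite /path_mean big_seq [RHS]big_seq.
by apply: eq_bigr => h /FG ->.
Qed.

Lemma path_meanD n F G :
  path_mean n (fun h => F h + G h) = path_mean n F + path_mean n G.
Proof.
by rewrite /path_mean -big_split; apply: eq_bigr => h _; rewrite mulrDr.
Qed.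

Lemma path_meanZ n a F : path_mean n (fun h => a * F h) = a * path_mean n F.
Proof.
by rewrite /path_mean big_distrr; apply: eq_bigr => h _ /=; rewrite mulrCA.
Qed.

Lemma path_meanB n F G :
  path_mean n (fun h => F h - G h) = path_mean n F - path_mean n G.
Proof.
rewrite path_meanD; congr (_ + _); rewrite -mulN1r -path_meanZ.
by apply: eq_path_mean => h _; rewrite mulN1r.
Qed.

(** The kernel moves one step outwards with probability [theta] and one step
    inwards with probability [1 - theta], except at [0], which both sides see
    as outward: in the eyes of a function of the distance to [0] the walk is
    the walk on [nat] reflected at [0]. *)
Definition radial_step (g : nat -> R) (k : nat) : R :=
  if k is k'.+1 then theta * g k.+1 + (1 - theta) * g k' else g 1%N.

Lemma step_mean_radial F g h :
  (forall y : int, F (y :: h) = g `|y|%N) ->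
  step_mean F h = radial_step g (distance h).
Proof.
move=> Fg; rewrite /step_mean !Fg /single_well /distance.
set x := head 0 h.
have x1 : (x - 1 == x + 1) = false by apply/negbTE; lia.
rewrite eqxx x1 eqxx.
case: x {x1} => [[|k]|k].
- by rewrite /radial_step /= -mulrDl subrK mul1r.
- have -> : (1 <= Posz k.+1)%R by lia.
  have -> : absz (Posz k.+1 + 1)%R = k.+2 by lia.
  by have -> : absz (Posz k.+1 - 1)%R = k by lia.
- have -> : (1 <= Negz k)%R = false by lia.
  have -> : absz (Negz k + 1)%R = k by lia.
  have -> : absz (Negz k - 1)%R = k.+2 by lia.
  by rewrite addrC.
Qed.

Lemma path_mean1 n : path_mean n (fun=> 1) = 1.
Proof.
elim: n => [|n IH]; first exact: path_mean0.
rewrite path_meanS -[RHS]IH; apply: eq_path_mean => h _.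
rewrite (@step_mean_radial _ (fun=> 1)) // /radial_step.
by case: (distance h) => // k; ring.
Qed.

Hypothesis theta01 : 0 <= theta <= 1.

Lemma weight_ge0 h : 0 <= weight h.
Proof.
have [t0 t1] := andP theta01.
elim: h => [//|y [//|x h] IH]; rewrite weight_cons // mulr_ge0 // /single_well.
by case: ifP => _; case: ifP => _; rewrite ?t0 ?subr_ge0 //; case: ifP;
  rewrite ?subr_ge0.
Qed.

Lemma le_path_mean n F G :
  (forall h, h \in histories n -> F h <= G h) -> path_mean n F <= path_mean n G.
Proof.
move=> FG; rewrite /path_mean big_seq [leRHS]big_seq.
by apply: ler_sum => h /FG FGh; rewrite ler_wpM2l // weight_ge0.
Qed.

Lemma path_mean_ge0 n F :
  (forall h, h \in histories n -> 0 <= F h) -> 0 <= path_mean n F.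
Proof.
move=> F0; rewrite /path_mean big_seq; apply: sumr_ge0 => h /F0.
by apply: mulr_ge0; exact: weight_ge0.
Qed.

End Histories.

(** * The law of the history *)

Section History.
Context {T : Type} (X : nat -> T -> int).

Fixpoint history (n : nat) (w : T) : seq int :=
  X n w :: if n is n'.+1 then history n' w else [::].

Lemma head_history n w : head 0 (history n w) = X n w.
Proof. by case: n. Qed.

Lemma distance_history n w : distance (history n w) = absz (X n w).
Proof. by rewrite /distance head_history. Qed.

Lemma all_history (a : pred int) n w :
  all a (history n w) <-> forall i, (i <= n)%N -> a (X i w).
Proof.
elim: n => [|n IH] /=.
  by rewrite andbT; split=> [aX i|/(_ 0%N)]; [rewrite leqn0 => /eqP ->|exact].
split=> [/andP[aX /IH aH] i|aX].
  by rewrite leq_eqVlt => /predU1P[->//|]; rewrite ltnS => /aH.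
by apply/andP; split; [exact: aX|apply/IH => i /leqW; exact: aX].
Qed.

Lemma history_eq n w h : size h = n.+1 ->
  history n w = h <-> forall i, (i <= n)%N -> X i w = nth 0 h (n - i).
Proof.
elim: n h => [|n IH] [|y h]//= [sh].
  move/size0nil: sh => ->; split=> [[<-] i|/(_ 0%N isT) /= ->//].
  by rewrite leqn0 => /eqP ->.
split=> [[<- /(IH _ sh) Xh] i|Xh].
  rewrite leq_eqVlt => /predU1P[->|]; first by rewrite subnn.
  by rewrite ltnS => lein; rewrite subSn //= Xh.
rewrite (Xh _ (leqnn _)) subnn /=; congr cons; apply/(IH _ sh) => i lein.
by rewrite Xh ?leqW // subSn.
Qed.

End History.

Section HistoryLaw.
Context {R : realType} (theta : R).
Context {d : measure_display} {T : measurableType d} (P : probability T R).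
Context (X : nat -> T -> int).
Hypothesis hX : markov_chain P (single_well theta) 0 X.

Lemma measurable_history n (B : set (seq int)) :
  measurable [set w | B (history X n w)].
Proof.
have mX m x : measurable [set w | X m w = x] by case: hX.
have m1 h : measurable [set w | history X n w = h].
  elim: n h => [|m IH] [|y h].
  - by rewrite [X in measurable X](_ : _ = set0) //; apply/seteqP; split.
  - case: h => [|z h]; last first.
      by rewrite [X in measurable X](_ : _ = set0) //; apply/seteqP; split.
    by rewrite [X in measurable X](_ : _ = [set w | X 0 w = y]) //;
      apply/seteqP; split => w /= [->].
  - by rewrite [X in measurable X](_ : _ = set0) //; apply/seteqP; split.
  - rewrite [X in measurable X](_ : _ =
      [set w | X m.+1 w = y] `&` [set w | history X m w = h]); last first.
      by apply/seteqP; split => w /= [-> ->].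
    exact: measurableI.
rewrite [X in measurable X](_ : _ =
  \bigcup_h ([set w | history X n w = h] `&` [set _ | B h])); last first.
  apply/seteqP; split => [w Bw|w [h _ [/= -> //]]].
  by exists (history X n w).
apply: countable_bigcupT_measurable => [|h]; first exact: countableP.
apply: measurableI => //; have [Bh|nBh] := pselect (B h).
  by rewrite [X in measurable X](_ : _ = setT) //; apply/seteqP; split.
by rewrite [X in measurable X](_ : _ = set0) //; apply/seteqP; split.
Qed.

Lemma measurable_fun_history n (F : seq int -> R) :
  measurable_fun [set: T] (fun w => (F (history X n w))%:E).
Proof.
move=> _ Y _; rewrite setTI.
exact: (measurable_history n [set h | Y (F h)%:E]).
Qed.

(** All that is used of the Markov property: what follows only takes means
    over the finite list of nearest-neighbour histories. *)
Lemma probability_history n h : h \in histories n ->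
  P [set w | history X n w = h] = (weight theta h)%:E.
Proof.
have [_ X0 Xstep] := hX.
elim: n h => [|n IH] h.
  rewrite inE => /eqP ->; rewrite -[RHS]X0; congr (P _).
  by apply/seteqP; split => w /= => [[->]|->].
move=> /allpairsP[[h' e] /= [hh' _ ->]]; set y := _ + e.
have sh' := size_histories hh'.
have h'0 : h' != [::] by case: (h') sh'.
pose s i := nth 0 (y :: h') (n.+1 - i).
transitivity (P [set w | forall i, (i <= n.+1)%N -> X i w = s i]).
  have sh : size (y :: h') = n.+2 by rewrite /= sh'.
  congr (P _); apply/seteqP; split => w; first by move/(history_eq X w sh).
  by move=> /(history_eq X w sh).
rewrite Xstep weight_cons // EFinM -IH //.
congr (P _ * (single_well _ _ _)%:E)%E.
- apply/seteqP; split => w /= Xs.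
    by apply/history_eq => // i lein; rewrite Xs // /s subSn.
  by move=> i lein; move/(history_eq X w sh'): Xs => ->//; rewrite /s subSn.
- by rewrite /s subSn // subnn /= nth0.
- by rewrite /s subnn.
Qed.

(** The weights of the listed histories add up to [1], so the history is almost
    surely one of them and the integral is a finite sum. *)
Lemma expectation_history n (F : seq int -> R) : (forall h, 0 <= F h) ->
  (\int[P]_w (F (history X n w))%:E)%E = (path_mean theta n F)%:E.
Proof.
move=> F0; pose C h := [set w | history X n w = h].
pose D := \big[setU/set0]_(h <- histories n) C h.
have mC h : measurable (C h) by exact: (measurable_history n [set h]).
have tC : trivIset [set` histories n] C by move=> h h' _ _ [w [<- <-]].
have mD : measurable D by exact: bigsetU_measurable.
have intD (G : seq int -> R) : (forall h, 0 <= G h) ->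
    (\int[P]_(w in D) (G (history X n w))%:E)%E = (path_mean theta n G)%:E.
  move=> G0; rewrite ge0_integral_bigsetU ?uniq_histories //; last 2 first.
  - exact/measurable_funTS/measurable_fun_history.
  - by move=> w _; rewrite lee_fin.
  rewrite /path_mean -sumEFin big_seq [RHS]big_seq; apply: eq_bigr => h hh.
  rewrite (@eq_integral _ _ _ _ _ (cst (G h)%:E)); last first.
    by move=> w; rewrite inE /= => ->.
  rewrite integral_cst // [X in (_ * X)%E]probability_history //.
  by rewrite -EFinM mulrC.
have PD : P D = 1%E.
  have := intD (fun=> 1) (fun=> ler01).
  by rewrite path_mean1 integral_cst // mul1e.
rewrite -intD // (@ge0_negligible_integral _ _ _ _ _ (~` D)) //.
- by rewrite setDE setCK setTI.
- exact: measurableC.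
- exact: measurable_fun_history.
- by move=> w _; rewrite lee_fin.
- by have := probability_setC P mD; rewrite PD subee.
Qed.

Lemma probability_history_pred n (b : pred (seq int)) :
  P [set w | b (history X n w)] = (path_mean theta n (fun h => (b h)%:R))%:E.
Proof.
rewrite -expectation_history; last by move=> h; rewrite ler0n.
rewrite -[X in P X = _]setIT -(integral_indic _ measurableT); last first.
  exact: (measurable_history n [set h | b h]).
apply: eq_integral => w _; rewrite indicE; congr (_%:R%:E).
by congr nat_of_bool; apply/idP/idP; rewrite inE.
Qed.

End HistoryLaw.

(** * The mean hitting time of a level *)

Section MeanHittingTime.
Context {R : realType} (theta : R).

(** The mean time the reflected walk takes from [j] to [j.+1]: a failed first
    step costs a passage from [j.-1] to [j] and a new attempt. *)
Fixpoint crossing_time (j : nat) : R :=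
  if j is j'.+1 then (1 + (1 - theta) * crossing_time j') / theta else 1.

Definition mean_hitting (k : nat) : R := \sum_(j < k) crossing_time j.

Definition alive (N : nat) : pred (seq int) := all (fun x => absz x < N)%N.

Definition survival (N n : nat) : R :=
  path_mean theta n (fun h => (alive N h)%:R).

(** The mean of the time still to be waited at time [n], that is
    E((tau_N - n)^+). *)
Definition residual (N n : nat) : R :=
  path_mean theta n
    (fun h => (alive N h)%:R * (mean_hitting N - mean_hitting (distance h))).

Lemma alive_distance N h : (0 < N)%N -> alive N h -> (distance h < N)%N.
Proof. by move=> N0; case: h => //= x h /andP[]. Qed.

(** A nearest-neighbour path started inside cannot be outside without having
    visited the boundary. *)
Lemma alive_avoids N n h : (0 < N)%N -> h \in histories n ->
  alive N h = all (fun x => absz x != N) h.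
Proof.
move=> N0; elim: n h => [|n IH] h.
  by rewrite inE => /eqP ->; rewrite /= N0 neq_ltn N0.
move=> /allpairsP[[h' e] /= [/IH hh' he ->]] /=; rewrite -hh'.
have [ah|] := boolP (alive N h'); last by rewrite !andbF.
rewrite !andbT; have := alive_distance N0 ah; rewrite /distance.
by move: he; rewrite !inE => /orP[]/eqP -> dN; move: (head _ _) dN => x dN; lia.
Qed.

Hypothesis theta01 : 0 < theta <= 1.

Let theta_gt0 : 0 < theta. Proof. by case/andP: theta01. Qed.
Let theta_le1 : theta <= 1. Proof. by case/andP: theta01. Qed.
Let theta_ge0_le1 : 0 <= theta <= 1. Proof. by rewrite ltW. Qed.

Lemma crossing_time_ge0 j : 0 <= crossing_time j.
Proof.
elim: j => [|j IH] /=; first exact: ler01.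
by rewrite divr_ge0 ?(ltW theta_gt0) // addr_ge0 // mulr_ge0 // subr_ge0.
Qed.

Lemma mean_hittingS k : mean_hitting k.+1 = mean_hitting k + crossing_time k.
Proof. by rewrite /mean_hitting big_ord_recr. Qed.

Lemma mean_hitting0 : mean_hitting 0 = 0.
Proof. by rewrite /mean_hitting big_ord0. Qed.

Lemma le_mean_hitting j k : (j <= k)%N -> mean_hitting j <= mean_hitting k.
Proof.
elim: k => [|k IH]; first by rewrite leqn0 => /eqP ->.
rewrite leq_eqVlt => /predU1P[->//|]; rewrite ltnS => /IH /le_trans; apply.
by rewrite mean_hittingS lerDl crossing_time_ge0.
Qed.

Lemma mean_hitting_ge0 k : 0 <= mean_hitting k.
Proof. by rewrite -mean_hitting0 le_mean_hitting. Qed.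

Lemma mean_hitting_ge1 k : (0 < k)%N -> 1 <= mean_hitting k.
Proof.
by move=> /le_mean_hitting; rewrite mean_hittingS mean_hitting0 add0r.
Qed.

Lemma radial_step_mean_hitting k :
  radial_step theta mean_hitting k = mean_hitting k + 1.
Proof.
case: k => [|k]; rewrite /radial_step !mean_hittingS ?mean_hitting0 ?add0r //=.
by field; rewrite gt_eqF.
Qed.

Lemma survival_ge0 N n : 0 <= survival N n.
Proof. by apply: path_mean_ge0 => // h _; rewrite ler0n. Qed.

Section Boundary.
Context (N : nat).
Hypothesis N_gt0 : (0 < N)%N.

Lemma residual0 : residual N 0 = mean_hitting N.
Proof. by rewrite /residual path_mean0 /= N_gt0 mul1r mean_hitting0 subr0. Qed.

(** The remaining time vanishes on the boundary, so that killing the walk there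
    is invisible in the one-step mean, and [mean_hitting] behaves as if there
    were no killing. *)
Lemma residualS n : residual N n.+1 = residual N n - survival N n.
Proof.
rewrite /residual path_meanS /survival -path_meanB; apply: eq_path_mean => h _.
have [ah|ah] := boolP (alive N h); last first.
  rewrite (@step_mean_radial _ _ _ (fun=> 0)) => [|y]; last first.
    by rewrite /= (negbTE ah) andbF mul0r.
  by rewrite !mul0r subrr /radial_step; case: (distance h) => //= k; ring.
have dN := alive_distance N_gt0 ah.
rewrite !mul1r.
set g := fun k => (k < N)%:R * (mean_hitting N - mean_hitting k).
rewrite (@step_mean_radial _ _ _ g) => [|y]; last first.
  by rewrite /g /= ah andbT.
have gE k : (k <= N)%N -> g k = mean_hitting N - mean_hitting k.
  rewrite leq_eqVlt /g => /predU1P[->|->]; last by rewrite mul1r.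
  by rewrite ltnn mul0r subrr.
have := radial_step_mean_hitting (distance h).
case: (distance h) dN => [|k] dN; rewrite /radial_step /=.
  by rewrite gE // => ->; ring.
by move=> Vk; rewrite !gE ?(ltnW (ltnW dN)) //; lra.
Qed.

Lemma sum_survival n :
  \sum_(k < n) survival N k = mean_hitting N - residual N n.
Proof.
elim: n => [|n IH]; first by rewrite big_ord0 residual0 subrr.
by rewrite big_ord_recr /= IH residualS //; ring.
Qed.

Lemma residual_bounds n :
  0 <= residual N n <= mean_hitting N * survival N n.
Proof.
apply/andP; split.
  apply: path_mean_ge0 => // h _.
  have [ah|] := boolP (alive N h); last by rewrite mul0r.
  by rewrite mul1r subr_ge0 le_mean_hitting // ltnW // alive_distance.
rewrite -path_meanZ; apply: le_path_mean => // h _.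
have [_|_] := boolP (alive N h); last by rewrite mul0r mulr0.
by rewrite mul1r mulr1 gerBl mean_hitting_ge0.
Qed.

(** The survival probabilities have bounded sums, hence tend to [0]; since they
    dominate the residual, it tends to [0] as well. *)
Lemma cvg_series_survival : series (survival N) @ \oo --> mean_hitting N.
Proof.
have seriesE n : series (survival N) n = mean_hitting N - residual N n.
  by rewrite /series /= big_mkord sum_survival.
have cvg_series : cvgn (series (survival N)).
  apply: nondecreasing_is_cvgn.
    by apply: nondecreasing_series => n _ _; exact: survival_ge0.
  exists (mean_hitting N) => _ [n _ <-]; rewrite seriesE gerBl.
  by case/andP: (residual_bounds n).
have surv0 := cvg_series_cvg_0 cvg_series.
have resid0 : residual N @ \oo --> (0 : R).
  apply: (@squeeze_cvgr _ _ _ _ (fun=> 0)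
    (fun n => mean_hitting N * survival N n)).
  - by near=> n; exact: residual_bounds.
  - exact: cvg_cst.
  - by rewrite -(mulr0 (mean_hitting N)); apply: cvgMr.
rewrite [X in X @ _](_ : _ =
  fun n => mean_hitting N - residual N n); last first.
  by apply/funext => n; rewrite seriesE.
by rewrite -[X in _ --> X]subr0; apply: cvgB => //; exact: cvg_cst.
Unshelve. all: by end_near. Qed.

End Boundary.

End MeanHittingTime.

(** * Law and mean of the hitting time *)

Section HittingTime.
Context {R : realType} {T : Type} (X : nat -> T -> int) (N : nat).

Lemma boundaryE (x : int) : [set (- N%:Z)%R; N%:Z] x <-> absz x = N.
Proof. by split=> [[]->|]; [lia|lia|rewrite /=; lia]. Qed.

Lemma tau_cases w :
  (exists m, [/\ tau (R := R) X N w = (m%:R)%:E, absz (X m w) = N &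
                 forall i, (i < m)%N -> absz (X i w) != N]) \/
  (tau (R := R) X N w = +oo%E /\ forall i, absz (X i w) != N).
Proof.
have [ex|nex] := pselect (exists n, absz (X n w) == N).
  left; exists (ex_minn ex); case: ex_minnP => m /eqP Xm min_m; split => //.
    apply/eqP; rewrite eq_le; apply/andP; split.
      by apply: ereal_inf_lbound; exists m => //=; apply/boundaryE.
    apply: le_ereal_inf_tmp => _ [n /boundaryE/eqP Xn <-].
    by rewrite lee_fin ler_nat min_m.
  by move=> i; rewrite ltnNge; apply: contraNN; exact: min_m.
right; have avoid i : absz (X i w) != N.
  by apply/negP => Xi; apply: nex; exists i.
split=> //; rewrite /tau /hitting_time [X in ereal_inf X](_ : _ = set0).
  exact: ereal_inf0.
apply/seteqP; split => // t [n /boundaryE/eqP Xn _].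
by move: (avoid n); rewrite Xn.
Qed.

Lemma tau_gt n w :
  ((n%:R)%:E < tau (R := R) X N w)%E =
  all (fun x => absz x != N) (history X n w).
Proof.
have [[m [-> Xm before]]|[-> avoid]] := tau_cases w; last first.
  by rewrite ltry; apply/esym/all_history => i _; exact: avoid.
rewrite lte_fin ltr_nat; apply/idP/idP => [nm|/all_history Xn].
  by apply/all_history => i /leq_ltn_trans/(_ nm)/before.
by rewrite ltnNge; apply/negP => /Xn; rewrite Xm eqxx.
Qed.

(** The layer-cake formula for a random time. *)
Lemma tau_series w :
  tau X N w = (\sum_(n <oo)
    ((all (fun x => absz x != N) (history X n w))%:R : R)%:E)%E.
Proof.
under eq_eseriesr do rewrite -tau_gt.
have [[m [-> _ _]]|[-> _]] := tau_cases w.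
  rewrite (nneseries_split 0 m) => [|k _]; last by rewrite lee_fin ler0n.
  rewrite add0n [X in (_ + X)%E]eseries0 => [|k mk _]; last first.
    by rewrite lte_fin ltr_nat ltnNge mk.
  rewrite adde0 sumEFin; congr EFin.
  rewrite -[LHS]mul1r -[m in LHS]subn0 mulr_natr -sumr_const_nat.
  rewrite big_nat [RHS]big_nat.
  by apply: eq_bigr => k /andP[_ km]; rewrite lte_fin ltr_nat km.
apply/esym/eqyP => A A0.
have term0 k : (0 <= k)%N -> true ->
    (0 <= (((k%:R)%:E < (+oo : \bar R))%E%:R : R)%:E)%E.
  by rewrite lee_fin ler0n.
apply: le_trans (nneseries_lim_ge (Num.truncn A).+1 term0).
rewrite (eq_bigr (fun=> 1%:E)) => [|k _]; last by rewrite ltry.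
rewrite sumEFin sumr_const_nat subn0 lee_fin.
by have /andP[_ /ltW] := truncn_itv (ltW A0).
Qed.

End HittingTime.

Section MeanHitting.
Context {R : realType} (theta : R).
Context {d : measure_display} {T : measurableType d} (P : probability T R).
Context (X : nat -> T -> int) (N : nat).
Hypothesis hX : markov_chain P (single_well theta) 0 X.
Hypothesis theta01 : 0 < theta <= 1.
Hypothesis N_gt0 : (0 < N)%N.

Lemma probability_tau_gt n :
  P [set w | ((n%:R)%:E < tau (R := R) X N w)%E] = (survival theta N n)%:E.
Proof.
rewrite [X in P X](_ : _ =
    [set w | all (fun x => absz x != N) (history X n w)]); last first.
  by apply/seteqP; split => w /=; rewrite tau_gt.
rewrite (probability_history_pred hX); congr EFin.
by apply: eq_path_mean => h /(alive_avoids N_gt0) ->.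
Qed.

Lemma expectation_tau : (\int[P]_w tau X N w)%E = (mean_hitting theta N)%:E.
Proof.
under eq_integral do rewrite tau_series.
rewrite integral_nneseries //; last first.
  move=> n.
  exact: (measurable_fun_history hX n
    (fun h => (all (fun x => absz x != N) h)%:R)).
under eq_eseriesr => n _.
  rewrite (expectation_history hX n
    (F := fun h => (all (fun x => absz x != N) h)%:R)); last first.
    by move=> h; rewrite ler0n.
  rewrite -(@eq_path_mean _ _ _ (fun h => (alive N h)%:R)); last first.
    by move=> h /(alive_avoids N_gt0) ->.
  over.
apply/cvg_lim => //.
under eq_fun do rewrite sumEFin.
by apply: cvg_EFin; [exact: nearW|exact: cvg_series_survival].
Qed.

End MeanHitting.

(** * Inward drift: exponential limit *)

Section ExponentialApproximation.
Context {R : realType}.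

Lemma expRN_quadratic (x : R) : 0 <= x -> 1 - x <= expR (- x) <= 1 - x + x ^+ 2.
Proof.
move=> x0; rewrite expR_ge1Dx /= expRN.
have x1 : 0 < 1 + x by rewrite ltr_pwDl.
apply: (@le_trans _ _ (1 + x)^-1).
  by rewrite lef_pV2 ?posrE ?expR_gt0 // expR_ge1Dx.
rewrite -[leLHS]mul1r ler_pdivrMr //.
have -> : (1 - x + x ^+ 2) * (1 + x) = 1 + x ^+ 3 by ring.
by rewrite lerDl exprn_ge0.
Qed.

(** A discrete Gronwall estimate: the recursion is the Euler scheme of
    f' = - f with step [x], the slope being known up to [eps]. *)
Lemma decay_approximation (F G : nat -> R) (x eps : R) :
  0 <= x <= 1 -> 0 <= eps -> F 0 = 1 -> (forall n, F n.+1 = F n - x * G n) ->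
  (forall n, `|G n - F n| <= eps) ->
  forall n, `|F n - expR (- (n%:R * x))| <= n%:R * (eps * x + x ^+ 2).
Proof.
move=> /andP[x0 x1] eps0 F0 FS GF; elim=> [|n IH].
  by rewrite F0 !mul0r oppr0 expR0 subrr normr0.
have /andP[e1 e2] := expRN_quadratic x0.
have en1 : expR (- (n%:R * x)) <= 1.
  by rewrite -[leRHS]expR0 ler_expR oppr_le0 mulr_ge0.
have en0 := expR_ge0 (- (n%:R * x)).
have -> : F n.+1 - expR (- (n.+1%:R * x)) =
    (1 - x) * (F n - expR (- (n%:R * x))) - x * (G n - F n)
    - expR (- (n%:R * x)) * (expR (- x) - (1 - x)).
  rewrite FS -natr1 mulrDl mul1r opprD expRD; ring.
have -> : n.+1%:R * (eps * x + x ^+ 2) =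
    n%:R * (eps * x + x ^+ 2) + x * eps + x ^+ 2 by rewrite -natr1; ring.
apply: (le_trans (ler_normB _ _)); apply: lerD.
  apply: (le_trans (ler_normB _ _)); apply: lerD.
    rewrite normrM ger0_norm ?subr_ge0 //.
    apply: le_trans (ler_wpM2r (normr_ge0 _) (_ : 1 - x <= 1)) _.
      by rewrite gerBl.
    by rewrite mul1r.
  by rewrite normrM ger0_norm // ler_wpM2l.
rewrite normrM !ger0_norm ?subr_ge0 // -[leRHS]mul1r.
by rewrite ler_pM ?subr_ge0 // lerBlDl.
Qed.

(** In units of [1 / x], stopping at an integer time instead of [t / x] costs at
    most one step, which is the last [x] of the bound. *)
Lemma decay_floor (F G : nat -> R) (x eps t : R) :
  0 < x <= 1 -> 0 <= eps -> F 0 = 1 -> (forall n, F n.+1 = F n - x * G n) ->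
  (forall n, `|G n - F n| <= eps) -> 0 <= t ->
  `|G (Num.truncn (t / x)) - expR (- t)| <= eps + t * (eps + x) + x.
Proof.
move=> /andP[x0 x1] eps0 F0 FS GF t0; set m := Num.truncn _.
have /andP[mt tm] : m%:R <= t / x < m.+1%:R.
  by apply: truncn_itv; rewrite divr_ge0 // ltW.
rewrite ler_pdivlMr // in mt; rewrite ltr_pdivrMr // -natr1 mulrDl mul1r in tm.
have Fm : `|F m - expR (- (m%:R * x))| <= t * (eps + x).
  apply: le_trans (decay_approximation _ _ F0 FS GF m) _ => //.
    by rewrite (ltW x0).
  have -> : eps * x + x ^+ 2 = x * (eps + x) by ring.
  by rewrite mulrA ler_wpM2r // addr_ge0 // ltW.
have em : `|expR (- (m%:R * x)) - expR (- t)| <= x.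
  have -> : - t = - (m%:R * x) + - (t - m%:R * x) by ring.
  have u0 : 0 <= t - m%:R * x by rewrite subr_ge0.
  have /andP[e1 _] := expRN_quadratic u0.
  have e2 : expR (- (t - m%:R * x)) <= 1.
    by rewrite -[leRHS]expR0 ler_expR oppr_le0.
  have e3 : expR (- (m%:R * x)) <= 1.
    by rewrite -[leRHS]expR0 ler_expR oppr_le0 mulr_ge0 // ltW.
  rewrite expRD -[X in X - _]mulr1 -mulrBr ger0_norm; last first.
    by rewrite mulr_ge0 ?expR_ge0 // subr_ge0.
  rewrite -[leRHS]mul1r ler_pM ?expR_ge0 ?subr_ge0 //.
  by rewrite lerBlDl; lra.
have -> : G m - expR (- t) = (G m - F m) + (F m - expR (- (m%:R * x)))
  + (expR (- (m%:R * x)) - expR (- t)) by ring.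
apply: le_trans (ler_normD _ _) _; apply: lerD => //.
by apply: le_trans (ler_normD _ _) _; apply: lerD.
Qed.

Lemma exponential_cdf (t : R) :
  exponential_prob 1 `]-oo, t]%classic =
  (if 0 <= t then 1 - expR (- t) else 0)%:E.
Proof.
rewrite /exponential_prob.
have -> : (fun x => (exponential_pdf (1 : R) x)%:E) =
    (fun x => ((1 : R) * expR (- 1 * x))%:E) \_ `[0, +oo[.
  by apply/funext => x; rewrite /exponential_pdf !patchE; case: ifP.
rewrite -integral_mkcondr.
case: ifPn => [t0|]; last first.
  rewrite -ltNge => t0; rewrite (_ : _ `&` _ = set0) ?integral_set0 //.
  apply/seteqP; split => // x /=; rewrite !in_itv /= andbT => -[xt x0].
  by move: (le_lt_trans xt t0); rewrite ltNge x0.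
have -> : `]-oo, t]%classic `&` `[0, +oo[%classic = `[0, t]%classic.
  apply/seteqP; split => x /=; rewrite !in_itv /= andbT; last by case/andP.
  by move=> [-> ->].
move: t0; rewrite le_eqVlt => /predU1P[<-|t0].
  by rewrite set_itv1 integral_set1 oppr0 expR0 subrr.
rewrite EFinB -[X in expR X]mulN1r -(exponential_prob_itv0c 1 t0) //.
rewrite /exponential_prob; apply: eq_integral => x; rewrite inE /= in_itv /=.
by case/andP => x0 _; rewrite exponential_pdfE.
Qed.

End ExponentialApproximation.

Section InwardDrift.
Context {R : realType} (theta : R).
Hypothesis theta_inward : 0 < theta < 1 / 2.

Let theta_gt0 : 0 < theta. Proof. by case/andP: theta_inward. Qed.
Let theta_lt1 : theta < 1. Proof. by case/andP: theta_inward => _; lra. Qed.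
Let theta01 : 0 < theta <= 1. Proof. by rewrite theta_gt0 ltW. Qed.
Let theta_ge0_le1 : 0 <= theta <= 1. Proof. by rewrite !ltW. Qed.

(** The mean hitting times grow like the powers of [(1 - theta) / theta]. Its
    square root is the base of the exponential moment of the distance which
    contracts fastest, and lies strictly below the growth rate of the mean
    hitting times. *)
Let s : R := Num.sqrt ((1 - theta) / theta).

Let sqr_s : theta * s ^+ 2 = 1 - theta.
Proof.
rewrite sqr_sqrtr ?divr_ge0 ?subr_ge0 ?ltW //.
by field; rewrite gt_eqF.
Qed.

Let s_gt1 : 1 < s.
Proof.
rewrite -sqrtr1 ltr_sqrt ?divr_gt0 ?subr_gt0 // ltr_pdivlMr //.
by case/andP: theta_inward => _; lra.
Qed.

Let s_gt0 : 0 < s. Proof. by rewrite (lt_trans ltr01). Qed.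

Let contraction : 2 * theta * s < 1.
Proof.
rewrite -[ltRHS]sqrtr1 -[ltLHS]ger0_norm; last first.
  by rewrite !mulr_ge0 // ltW.
rewrite -sqrtr_sqr ltr_sqrt //.
have -> : (2 * theta * s) ^+ 2 = 4 * theta * (theta * s ^+ 2) by ring.
rewrite sqr_s; case/andP: theta_inward => _ t2.
have : 0 < (1 - 2 * theta) ^+ 2 by rewrite exprn_gt0 //; lra.
by nra.
Qed.

Lemma mean_hitting_growth k :
  s ^+ 2 * mean_hitting theta k <= mean_hitting theta k.+1.
Proof.
rewrite /mean_hitting big_ord_recl mulr_sumr -[leLHS]add0r.
apply: lerD; first exact: crossing_time_ge0.
apply: ler_sum => j _ /=; rewrite ler_pdivlMr // mulrAC [_ * theta]mulrC sqr_s.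
by rewrite lerDr ler01.
Qed.

(** Only half of the growth is kept, in order to match the exponential moment
    with base [s]. *)
Lemma mean_hitting_expn_le k m :
  s ^+ m * mean_hitting theta k <= mean_hitting theta (k + m).
Proof.
elim: m => [|m IH]; first by rewrite mul1r addn0.
rewrite addnS (le_trans _ (mean_hitting_growth _)) // exprS -mulrA expr2 -mulrA.
rewrite ler_pM2l // (le_trans IH) // ler_peMl ?(ltW s_gt1) //.
exact: mean_hitting_ge0.
Qed.

Let C : R := s / (1 - 2 * theta * s) + 1.

Let C_ge0 : 0 <= C.
Proof. by rewrite addr_ge0 // divr_ge0 ?subr_ge0 // ltW. Qed.

(** The inward drift confines the walk: away from [0], one step multiplies the
    mean of the Foster-Lyapunov function [s ^+ distance] by
    [2 * theta * s < 1]. *)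
Lemma exponential_moment n :
  path_mean theta n (fun h => s ^+ distance h) <= C.
Proof.
have c1 : 0 < 1 - 2 * theta * s by rewrite subr_gt0.
elim: n => [|n IH].
  by rewrite path_mean0 /= expr0 /C lerDr divr_ge0 ?ltW.
rewrite path_meanS.
apply: (@le_trans _ _ (path_mean theta n
  (fun h => 2 * theta * s * s ^+ distance h + s * 1))).
  apply: le_path_mean => // h _.
  rewrite (@step_mean_radial _ _ _ (fun k => s ^+ k)) // mulr1 /radial_step.
  case: (distance h) => [|k].
    by rewrite expr0 mulr1 expr1 lerDr !mulr_ge0 // ltW.
  rewrite -sqr_s -[leLHS]addr0 lerD ?(ltW s_gt0) //.
  by rewrite le_eqVlt !exprS; apply/orP; left; apply/eqP; ring.
rewrite path_meanD !path_meanZ path_mean1 mulr1.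
apply: (@le_trans _ _ (2 * theta * s * C + s)).
  by rewrite lerD2r ler_wpM2l // !mulr_ge0 // ltW.
have -> : 2 * theta * s * C + s = C - (1 - 2 * theta * s).
  by rewrite /C; field; rewrite gt_eqF.
by rewrite gerBl ltW.
Qed.

(** Conditioning on survival hardly changes the mean remaining time: the walk
    sits near [0], where the mean remaining time is close to [V(N)]. *)
Lemma survival_residual N n : (0 < N)%N ->
  `|survival theta N n - residual theta N n / mean_hitting theta N|
    <= C * s^-1 ^+ N.
Proof.
move=> N0; have V0 : 0 < mean_hitting theta N.
  by rewrite (lt_le_trans ltr01) // mean_hitting_ge1.
have /andP[_ resid] := residual_bounds theta01 N0 n.
rewrite ger0_norm; last by rewrite subr_ge0 ler_pdivrMr // mulrC.
have -> : survival theta N n - residual theta N n / mean_hitting theta N =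
    (mean_hitting theta N * survival theta N n - residual theta N n)
    / mean_hitting theta N by field; rewrite gt_eqF.
rewrite ler_pdivrMr // -path_meanZ /residual -path_meanB.
have -> : C * s^-1 ^+ N * mean_hitting theta N =
  mean_hitting theta N * s^-1 ^+ N * C by ring.
have Vs0 : 0 <= mean_hitting theta N * s^-1 ^+ N.
  by rewrite mulr_ge0 ?(ltW V0) // exprn_ge0 // invr_ge0 ltW.
apply: le_trans (ler_wpM2l Vs0 (exponential_moment n)).
rewrite -path_meanZ; apply: le_path_mean => // h _.
have [ah|_] := boolP (alive N h); last first.
  by rewrite mul0r mulr0 subrr !mulr_ge0 ?exprn_ge0 ?invr_ge0 ?ltW.
rewrite mul1r mulr1 opprB addrC subrK.
have dN := ltnW (alive_distance N0 ah).
have := mean_hitting_expn_le (distance h) (N - distance h).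
rewrite subnKC // => le.
rewrite exprVn mulrAC ler_pdivlMr ?exprn_gt0 //.
rewrite -[in s ^+ N](subnK dN) exprD mulrA ler_wpM2r ?exprn_ge0 ?(ltW s_gt0) //.
by rewrite mulrC.
Qed.

Lemma cvg_expn_invs : GRing.exp s^-1 @ \oo --> (0 : R).
Proof.
apply: cvg_expr; rewrite ger0_norm ?invr_ge0 ?(ltW s_gt0) //.
by rewrite invf_lt1.
Qed.

Lemma cvg_inv_mean_hitting : (mean_hitting theta N)^-1 @[N --> \oo] --> (0 : R).
Proof.
apply: (@squeeze_cvgr _ _ _ _ (fun=> 0) (fun N => s * s^-1 ^+ N)).
- near=> N; have N0 : (0 < N)%N by near: N; exact: nbhs_infty_gt.
  have := mean_hitting_expn_le 1 N.-1; rewrite add1n prednK //.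
  rewrite mean_hittingS mean_hitting0 add0r mulr1 => leV.
  have sN : 0 < s ^+ N.-1 by rewrite exprn_gt0.
  rewrite invr_ge0 mean_hitting_ge0 //=.
  apply: (@le_trans _ _ (s ^+ N.-1)^-1).
    by rewrite lef_pV2 ?posrE // (lt_le_trans sN).
  rewrite exprVn -[in leRHS](prednK N0) exprS invfM mulrA divff ?mul1r //.
  by rewrite gt_eqF.
- exact: cvg_cst.
- by rewrite -(mulr0 s); apply: cvgMr; exact: cvg_expn_invs.
Unshelve. all: by end_near. Qed.

Lemma survival_decay (t : R) : 0 <= t ->
  survival theta N (Num.truncn (t * mean_hitting theta N)) @[N --> \oo]
    --> expR (- t).
Proof.
move=> t0; pose eps N : R := C * s^-1 ^+ N.
pose x N := (mean_hitting theta N)^-1.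
have eps_to0 : eps @ \oo --> (0 : R).
  by rewrite -(mulr0 C); apply: cvgMr; exact: cvg_expn_invs.
have x_to0 : x @ \oo --> (0 : R) := cvg_inv_mean_hitting.
apply/cvgrPdist_le => e e0.
have err_to0 : (eps N + t * (eps N + x N) + x N) @[N --> \oo] --> (0 : R).
  rewrite -[X in _ --> X]addr0 -[X in _ --> X + _]addr0.
  apply: cvgD => //; apply: cvgD => //.
  rewrite -(mulr0 t); apply: cvgMr.
  by rewrite -[X in _ --> X]addr0; exact: cvgD.
have /cvgrPdist_le /(_ e e0) err_small := err_to0.
near=> N; have N0 : (0 < N)%N by near: N; exact: nbhs_infty_gt.
have V1 : 1 <= mean_hitting theta N by rewrite mean_hitting_ge1.
have V0 : 0 < mean_hitting theta N by rewrite (lt_le_trans ltr01).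
rewrite distrC -[mean_hitting theta N]invrK -/(x N).
apply: le_trans (_ : _ <= eps N + t * (eps N + x N) + x N) _.
  apply: (decay_floor
    (F := fun n => residual theta N n / mean_hitting theta N)) => //.
  - by rewrite invr_gt0 V0 invf_le1.
  - by rewrite mulr_ge0 // exprn_ge0 // invr_ge0 ltW.
  - by rewrite residual0 // divff // gt_eqF.
  - by move=> n; rewrite residualS // mulrBl [x N * _]mulrC.
  - by move=> n; exact: survival_residual.
have : `|0 - (eps N + t * (eps N + x N) + x N)| <= e by near: N.
by rewrite sub0r normrN; apply: le_trans; exact: ler_norm.
Unshelve. all: by end_near. Qed.

End InwardDrift.

Section ExponentialLimit.
Context {R : realType} (theta : R).
Context {d : measure_display} {T : measurableType d} (P : probability T R).
Context (X : nat -> T -> int).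
Hypothesis hX : markov_chain P (single_well theta) 0 X.
Hypothesis theta_inward : 0 < theta < 1 / 2.

Lemma normalized_tau_cvg_exponential :
  cvg_in_distribution P (normalized_tau P X) (exponential_prob 1).
Proof.
have theta01 : 0 < theta <= 1 by case/andP: theta_inward => -> /=; lra.
move=> t _; rewrite exponential_cdf.
pose m N := Num.truncn (t * mean_hitting theta N).
apply: (@cvg_trans _ ((if 0 <= t then 1 - survival theta N (m N) else 0)%:E
    @[N --> \oo])); last first.
  apply: cvg_EFin; first exact: nearW.
  case: ifP => t0; last exact: cvg_cst.
  by apply: cvgB; [exact: cvg_cst|exact: survival_decay].
apply: near_eq_cvg; near=> N.
have N0 : (0 < N)%N by near: N; exact: nbhs_infty_gt.
have V0 : 0 < mean_hitting theta N.
  by rewrite (lt_le_trans ltr01) // mean_hitting_ge1.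
have cdfE w : (normalized_tau P X N w <= t%:E)%E =
    (tau X N w <= (t * mean_hitting theta N)%:E)%E.
  rewrite /normalized_tau (expectation_tau hX theta01 N0) inver gt_eqF //.
  by rewrite lee_pdivrMr.
have [t0|t0] := leP 0 t; last first.
  rewrite [X in P X](_ : _ = set0) ?measure0 //.
  apply/seteqP; split => // w /=; rewrite cdfE leNgt => /negP; apply.
  apply: (@lt_le_trans _ _ 0%E).
    by rewrite lte_fin pmulr_llt0.
  by have [[k [-> _ _]]|[-> _]] := tau_cases (R := R) X N w; rewrite ?lee_fin.
rewrite [X in P X](_ : _ = ~` [set w | (((m N)%:R)%:E < tau (R := R) X N w)%E]).
  have mtau : measurable [set w | (((m N)%:R)%:E < tau (R := R) X N w)%E].
    rewrite [X in measurable X](_ : _ =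
      [set w | all (fun x => absz x != N) (history X (m N) w)]).
      exact: (measurable_history hX (m N)
        [set h | all (fun x => absz x != N) h]).
    by apply/seteqP; split => w /=; rewrite tau_gt.
  by rewrite probability_setC // (probability_tau_gt hX N0) EFinB.
apply/seteqP; split => w /=; rewrite cdfE.
  have [[k [-> _ _]]|[-> _]] := tau_cases (R := R) X N w; last first.
    by rewrite leNgt ltry.
  rewrite lee_fin lte_fin ltr_nat /m => kt.
  by rewrite truncn_lt_nat ?mulr_ge0 ?(ltW V0) // ltNge kt.
have [[k [-> _ _]]|[-> _]] := tau_cases (R := R) X N w; last by rewrite ltry.
rewrite lee_fin lte_fin ltr_nat /m truncn_lt_nat ?mulr_ge0 ?(ltW V0) //.
by move/negP; rewrite -leNgt.
Unshelve. all: by end_near. Qed.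

End ExponentialLimit.

(** * Outward drift: law of large numbers *)

Section SeriesAndInversion.
Context {R : realType}.

Lemma ae_series_lty (d : measure_display) (T : measurableType d)
    (P : probability T R) (f : nat -> T -> R) :
  (forall n, measurable_fun [set: T] (fun w => (f n w)%:E)) ->
  (forall n w, 0 <= f n w) ->
  (\sum_(n <oo) \int[P]_w (f n w)%:E < +oo)%E ->
  {ae P, forall w, (\sum_(n <oo) (f n w)%:E < +oo)%E}.
Proof.
move=> mf f0 sum_lty.
have int_sum : P.-integrable setT (fun w => (\sum_(n <oo) (f n w)%:E)%E).
  apply/integrableP; split.
    apply: (@ge0_emeasurable_sum _ _ _ _ (fun n w => (f n w)%:E) xpredT) => //.
    by move=> n w _ _; rewrite lee_fin.
  under eq_integral => w _.
    rewrite gee0_abs; last by apply: nneseries_ge0 => n _ _; rewrite lee_fin.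
    over.
  by rewrite integral_nneseries // => n w _; rewrite lee_fin.
apply: filterS (integrable_ae measurableT int_sum) => w /(_ I).
by rewrite fin_numE => /andP[_ finite_sum]; rewrite ltey.
Qed.

Lemma nneseries_lty_cvg0 (f : nat -> R) : (forall n, 0 <= f n) ->
  (\sum_(n <oo) (f n)%:E < +oo)%E -> f @ \oo --> (0 : R).
Proof.
move=> f0 sum_lty; apply: cvg_series_cvg_0; apply: nondecreasing_is_cvgn.
  by apply: nondecreasing_series => n _ _; exact: f0.
have sum_ge0 : (0 <= \sum_(n <oo) (f n)%:E)%E.
  by apply: nneseries_ge0 => n _ _; rewrite lee_fin.
exists (fine (\sum_(n <oo) (f n)%:E)) => _ [n _ <-].
rewrite -lee_fin fineK ?ge0_fin_numE // /series /= -sumEFin.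
by apply: nneseries_lim_ge => k _ _; rewrite lee_fin.
Qed.

Lemma inv_squares_lty : (\sum_(n <oo) ((n.+1%:R ^+ 2)^-1 : R)%:E < +oo)%E.
Proof.
have term0 n : (0 <= ((n.+1%:R ^+ 2)^-1 : R)%:E)%E.
  by rewrite lee_fin invr_ge0 exprn_ge0.
apply: (@le_lt_trans _ _ 2%:E); last exact: ltry.
apply: lime_le; first by apply: is_cvg_nneseries => n _ _.
near=> n; rewrite sumEFin lee_fin big_mkord.
(* 1 / (k + 1)^2 <= 2 / (k + 1) - 2 / (k + 2), and the majorant telescopes *)
suff : \sum_(i < n) (i.+1%:R ^+ 2)^-1 <= 2 - 2 / n.+1%:R :> R.
  by move=> /le_trans; apply; rewrite gerBl divr_ge0.
elim: {+}n => [|k IH]; first by rewrite big_ord0 divr1 subrr.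
rewrite big_ord_recr /=; apply: (le_trans (lerD IH (lexx _))).
have k1 : 0 < k.+1%:R :> R by [].
have k2 : k.+2%:R = k.+1%:R + 1 :> R by rewrite natr1.
rewrite k2; set y := k.+1%:R.
have y1 : 1 <= y by rewrite ler1n.
have -> : 2 - 2 / (y + 1) = 2 - 2 / y + 2 / (y * (y + 1)) :> R.
  by field; rewrite !gt_eqF // addr_gt0.
rewrite lerD2l -[leLHS]mul1r ler_pdivrMr ?exprn_gt0 // mulrAC.
rewrite ler_pdivlMr ?mulr_gt0 ?addr_gt0 // mul1r; nra.
Unshelve. all: by end_near. Qed.

(** Before a given time only finitely many values are taken, so [m N] tends to
    infinity; reading the limit of [Z n / n] at the time [m N] gives that of
    [N / m N], whatever the fluctuations of the hitting times. *)
Lemma cvg_along_hitting_times (Z m : nat -> nat) (l : R) :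
  (Z n.+1)%:R / n.+1%:R @[n --> \oo] --> l ->
  (forall N, (0 < N)%N -> Z (m N) = N) ->
  N%:R / (m N)%:R @[N --> \oo] --> l.
Proof.
move=> Zl Zm; apply/cvgrPdist_le => e e0.
have /cvgrPdist_le /(_ e e0) [K _ HK] := Zl.
near=> N.
have N0 : (0 < N)%N by near: N; exact: nbhs_infty_gt.
have mK : (K < m N)%N.
  have : (\sum_(k < K.+1) Z k < N)%N by near: N; exact: nbhs_infty_gt.
  apply: contraTltn => mNK; rewrite -leqNgt -[X in (X <= _)%N](Zm N N0).
  have mK1 : (m N < K.+1)%N by rewrite ltnS.
  by rewrite (bigD1 (Ordinal mK1)) //= leq_addr.
have := HK (m N).-1; rewrite /= prednK ?(leq_ltn_trans _ mK) // Zm //; apply.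
by rewrite -ltnS prednK // (leq_ltn_trans _ mK).
Unshelve. all: by end_near. Qed.

End SeriesAndInversion.

Section OutwardDrift.
Context {R : realType} (theta : R).
Hypothesis theta_outward : 1 / 2 < theta <= 1.

Let theta_gt0 : 0 < theta. Proof. by case/andP: theta_outward => + _; lra. Qed.
Let theta01 : 0 < theta <= 1.
Proof. by rewrite theta_gt0; case/andP: theta_outward. Qed.
Let theta_ge0_le1 : 0 <= theta <= 1.
Proof. by rewrite (ltW theta_gt0); case/andP: theta01. Qed.

Local Notation speed := (2 * theta - 1).
Local Notation odds := ((1 - theta) / theta).

Let speed_gt0 : 0 < speed. Proof. by case/andP: theta_outward => + _; lra. Qed.

Lemma crossing_timeE j :
  crossing_time theta j = (1 - 2 * (1 - theta) * odds ^+ j) / speed.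
Proof.
elim: j => [|j IH] /=.
  rewrite expr0 mulr1 (_ : 1 - 2 * (1 - theta) = speed); last by ring.
  by rewrite divff // gt_eqF.
by rewrite IH exprS; move: (odds ^+ j) => o; field; rewrite !gt_eqF.
Qed.

(** A particular solution of the one-step equation, linear in [k], plus a
    multiple of [1 - odds ^+ k], which is harmonic for the walk away from
    [0]. *)
Lemma mean_hittingE k : mean_hitting theta k =
  k%:R / speed - 2 * theta * (1 - theta) / speed ^+ 2 * (1 - odds ^+ k).
Proof.
elim: k => [|k IH].
  by rewrite mean_hitting0 expr0 subrr mulr0 mul0r subr0.
rewrite mean_hittingS IH crossing_timeE [odds ^+ k.+1]exprS -[k.+1%:R]natr1.
by move: (odds ^+ k) => o; field; rewrite !gt_eqF.
Qed.

Lemma cvg_mean_hitting :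
  mean_hitting theta N.+1 / N.+1%:R @[N --> \oo] --> speed^-1.
Proof.
set A := 2 * theta * (1 - theta) / speed ^+ 2.
have -> : (fun N => mean_hitting theta N.+1 / N.+1%:R) =
    (fun N => speed^-1 - A * (1 - odds ^+ N.+1) * N.+1%:R^-1).
  by apply/funext => N; rewrite mean_hittingE -/A; field; rewrite !gt_eqF.
have odds0 : odds ^+ N.+1 @[N --> \oo] --> (0 : R).
  rewrite (cvg_shiftS (GRing.exp odds)); apply: cvg_expr.
  have /andP[_ t1] := theta01.
  rewrite ger0_norm ?divr_ge0 ?subr_ge0 ?(ltW theta_gt0) //.
  by rewrite ltr_pdivrMr // mul1r; case/andP: theta_outward => + _; lra.
rewrite -[X in _ --> X]subr0; apply: cvgB; first exact: cvg_cst.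
rewrite -(mulr0 (A * (1 - 0))); apply: cvgM; last exact: cvg_harmonic.
by apply: cvgMr; apply: cvgB => //; exact: cvg_cst.
Qed.

(** Reflection acts only at [0], where the centred distance is at most [0]; the
    push upwards is then towards the mean, and the even moments obey the bounds
    they would satisfy for sums of independent steps. *)
Lemma second_moment n :
  path_mean theta n (fun h => ((distance h)%:R - speed * n%:R) ^+ 2) <= n%:R.
Proof.
have /andP[_ t1] := theta01; have s0 := speed_gt0.
elim: n => [|n IH]; first by rewrite path_mean0 /= mulr0 subrr expr0n.
rewrite path_meanS -[n.+1%:R]natr1.
apply: le_trans (_ : _ <= path_mean theta n
  (fun h => ((distance h)%:R - speed * n%:R) ^+ 2 + 1)) _; last first.
  by rewrite path_meanD path_mean1 lerD2r.
apply: le_path_mean => // h _.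
rewrite (@step_mean_radial _ _ _
  (fun k => (k%:R - speed * (n%:R + 1)) ^+ 2)) //.
have b0 : 0 <= speed * n%:R by rewrite mulr_ge0 // ltW.
rewrite mulrDr mulr1; set b := speed * n%:R in b0 *.
have c0 : 0 <= 1 - speed by lra.
have c1 : (1 - speed) ^+ 2 <= 1 by rewrite exprn_ile1 //; lra.
case: (distance h) => [|k]; rewrite /radial_step.
  rewrite -subr_ge0.
  have -> : (0 - b) ^+ 2 + 1 - (1 - (b + speed)) ^+ 2 =
    2 * (b * (1 - speed)) + (1 - (1 - speed) ^+ 2) by ring.
  by have := mulr_ge0 b0 c0; lra.
rewrite -[k.+2%:R]natr1 -[k.+1%:R]natr1; set a := k%:R.
have -> : theta * (a + 1 + 1 - (b + speed)) ^+ 2 +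
    (1 - theta) * (a - (b + speed)) ^+ 2 =
  (a + 1 - b) ^+ 2 + 1 - speed ^+ 2 by ring.
by rewrite gerBl sqr_ge0.
Qed.

Lemma fourth_moment n :
  path_mean theta n (fun h => ((distance h)%:R - speed * n%:R) ^+ 4)
    <= 10 * n%:R ^+ 2.
Proof.
have /andP[_ t1] := theta01; have s0 := speed_gt0.
elim: n => [|n IH].
  by rewrite path_mean0 /= mulr0 subrr !expr0n /= mulr0.
rewrite path_meanS -[n.+1%:R]natr1.
apply: le_trans (_ : _ <= path_mean theta n
  (fun h => ((distance h)%:R - speed * n%:R) ^+ 4
    + (10 * ((distance h)%:R - speed * n%:R) ^+ 2 + 8 * 1))) _; last first.
  rewrite path_meanD path_meanD !path_meanZ path_mean1.
  have := second_moment n; have : 0 <= n%:R :> R by []; nra.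
apply: le_path_mean => // h _.
rewrite (@step_mean_radial _ _ _
  (fun k => (k%:R - speed * (n%:R + 1)) ^+ 4)) //.
have b0 : 0 <= speed * n%:R by rewrite mulr_ge0 // ltW.
rewrite mulrDr mulr1; set b := speed * n%:R in b0 *.
case: (distance h) => [|k]; rewrite /radial_step.
  have -> : 1 - (b + speed) = (1 - speed) - b by ring.
  rewrite sub0r (_ : (- b) ^+ 4 = b ^+ 4); last by ring.
  rewrite -[leLHS]addr0.
  have : 0 <= 10 * (- b) ^+ 2 by rewrite mulr_ge0 // sqr_ge0.
  set c := 1 - speed; have c0 : 0 <= c by rewrite /c; lra.
  have c1 : c <= 1 by rewrite /c; lra.
  suff : (c - b) ^+ 4 <= b ^+ 4 + 1 by lra.
  have [bc|cb] := leP b c.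
    apply: (@le_trans _ _ 1); last by rewrite lerDr exprn_ge0.
    by rewrite exprn_ile1 //; lra.
  rewrite -[leLHS]addr0; apply: lerD => //.
  rewrite (_ : (c - b) ^+ 4 = (b - c) ^+ 4); last by ring.
  by rewrite lerXn2r ?nnegrE //; lra.
rewrite -[k.+2%:R]natr1 -[k.+1%:R]natr1; set a := k%:R + 1 - b.
have -> : k%:R + 1 + 1 - (b + speed) = a + 1 - speed by rewrite /a; ring.
have -> : k%:R - (b + speed) = a - 1 - speed by rewrite /a; ring.
(* [q] is the variance of a step *)
pose q := 4 * theta * (1 - theta).
have q0 : 0 <= q by rewrite /q !mulr_ge0 ?subr_ge0 ?(ltW theta_gt0).
have q1 : q <= 1 by rewrite /q; have := sqr_ge0 speed; nra.
rewrite -subr_ge0.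
(* the third moment of the step is [- 2 * speed * q]; its contribution is
   absorbed by completing the square *)
have -> : a ^+ 4 + (10 * a ^+ 2 + 8 * 1) - (theta * (a + 1 - speed) ^+ 4 +
   (1 - theta) * (a - 1 - speed) ^+ 4) =
  4 * (a + speed * q) ^+ 2 + 6 * (1 - q) * a ^+ 2
  + (8 - 4 * q + 3 * q ^+ 2 - 4 * (speed * q) ^+ 2).
  by rewrite /q; ring.
have sq1 : (speed * q) ^+ 2 <= 1.
  have sq0 : 0 <= speed * q by rewrite mulr_ge0 // ltW.
  by rewrite exprn_ile1 // mulr_ile1 // ?(ltW s0) //; lra.
have := sqr_ge0 (a + speed * q); have := sqr_ge0 q.
have : 0 <= 6 * (1 - q) * a ^+ 2.
  by apply: mulr_ge0; [rewrite mulr_ge0 // subr_ge0 | exact: sqr_ge0].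
lra.
Qed.

End OutwardDrift.

Section LawOfLargeNumbers.
Context {R : realType} (theta : R).
Context {d : measure_display} {T : measurableType d} (P : probability T R).
Context (X : nat -> T -> int).
Hypothesis hX : markov_chain P (single_well theta) 0 X.
Hypothesis theta_outward : 1 / 2 < theta <= 1.

Local Notation speed := (2 * theta - 1).

Let theta01 : 0 < theta <= 1.
Proof. by case/andP: theta_outward => t1 ->; rewrite andbT; lra. Qed.

Let speed_gt0 : 0 < speed. Proof. by case/andP: theta_outward => + _; lra. Qed.

(** The fourth powers of the deviations of the mean speed have expectations
    O(1/n^2): their sum has a finite expectation, so it is almost surely finite
    and its terms tend to [0]. *)
Lemma ae_distance_speed :
  {ae P, forall w, (absz (X n.+1 w))%:R / n.+1%:R @[n --> \oo] --> speed}.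
Proof.
pose F n h : R := (((distance h)%:R - speed * n.+1%:R) / n.+1%:R) ^+ 4.
have F0 n h : 0 <= F n h by rewrite /F (_ : 4%N = (2 * 2)%N) // exprM sqr_ge0.
have ae_sum : {ae P, forall w,
    (\sum_(n <oo) (F n (history X n.+1 w))%:E < +oo)%E}.
  apply: ae_series_lty => //.
    by move=> n; exact: (measurable_fun_history hX n.+1 (F n)).
  apply: (@le_lt_trans _ _
      (\sum_(n <oo) (10%:E * ((n.+1%:R ^+ 2)^-1 : R)%:E))%E); last first.
    rewrite nneseriesZl; last by move=> n _; rewrite lee_fin invr_ge0 exprn_ge0.
    by rewrite lte_mul_pinfty // ?lee_fin // inv_squares_lty.
  apply: lee_nneseries => [n _ _|n _].
    by apply: integral_ge0 => w _; rewrite lee_fin.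
  rewrite (expectation_history hX) // -EFinM lee_fin.
  rewrite (@eq_path_mean _ _ _ _ (fun h => (n.+1%:R ^+ 4)^-1 *
    ((distance h)%:R - speed * n.+1%:R) ^+ 4)); last first.
    by move=> h _; rewrite /F expr_div_n mulrC.
  rewrite path_meanZ.
  have inv0 : 0 <= (n.+1%:R ^+ 4)^-1 :> R by rewrite invr_ge0 exprn_ge0.
  apply: le_trans (ler_wpM2l inv0 (fourth_moment theta_outward n.+1)) _.
  have y0 : n.+1%:R != 0 :> R by rewrite pnatr_eq0.
  rewrite le_eqVlt; apply/orP; left; apply/eqP.
  by move: n.+1%:R y0 => y y0; field.
apply: filterS ae_sum => w sum_lty.
have Fto0 := nneseries_lty_cvg0 (fun n => F0 n _) sum_lty.
apply/cvgrPdist_le => e e0.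
have e40 : 0 < e ^+ 4 by rewrite exprn_gt0.
have /cvgrPdist_le /(_ _ e40) Fe := Fto0.
near=> n.
have : `|0 - F n (history X n.+1 w)| <= e ^+ 4 by near: n.
rewrite sub0r normrN ger0_norm // /F distance_history distrC.
have -> : (absz (X n.+1 w))%:R / n.+1%:R - speed =
    ((absz (X n.+1 w))%:R - speed * n.+1%:R) / n.+1%:R :> R.
  by rewrite mulrBl mulfK // pnatr_eq0.
set y := _ / _; rewrite -[y ^+ 4]ger0_norm; last first.
  by rewrite (_ : 4%N = (2 * 2)%N) // exprM sqr_ge0.
by rewrite normrX ler_pXn2r ?nnegrE // ltW.
Unshelve. all: by end_near. Qed.

Lemma ae_tau_lty :
  {ae P, forall w N, (0 < N)%N -> (tau X N w < +oo :> \bar R)%E}.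
Proof.
apply: ae_foralln => N; have [->|N0] := posnP N; first exact: nearW.
have mavoid n := measurable_fun_history hX n
  (fun h => (all (fun x => absz x != N) h)%:R).
have : {ae P, forall w, (\sum_(n <oo)
    ((all (fun x => absz x != N) (history X n w))%:R : R)%:E < +oo)%E}.
  apply: ae_series_lty => //.
  rewrite -integral_nneseries //.
  under eq_integral do rewrite -tau_series.
  by rewrite (expectation_tau hX) // ltry.
by apply: filterS => w + _; rewrite -tau_series.
Qed.

(** tau_N / V(N) = 1 / ((V(N) / N) * (N / tau_N)), and both factors converge,
    to inverse limits. *)
Lemma normalized_tau_ae_cvg1 :
  {ae P, forall w, (normalized_tau P X N w @[N --> \oo] --> 1)%E}.
Proof.
apply: filterS2 ae_distance_speed ae_tau_lty => w Zspeed tau_lty.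
have /choice[m tau_m] N : exists m, (0 < N)%N ->
    tau (R := R) X N w = (m%:R)%:E /\ absz (X m w) = N.
  have [->|N0] := posnP N; first by exists 0%N.
  have [[m [taum Xm _]]|[tau_oo _]] := tau_cases (R := R) X N w.
    by exists m.
  by have := tau_lty N N0; rewrite tau_oo ltxx.
have Nm := cvg_along_hitting_times (Z := fun n => absz (X n w)) Zspeed
  (fun N N0 => (tau_m N N0).2).
rewrite -cvg_shiftS.
have ratio : ((m N.+1)%:R / mean_hitting theta N.+1)%:E @[N --> \oo]
    --> (1%:E : \bar R).
  apply: cvg_EFin; first exact: nearW.
  rewrite -cvg_shiftS in Nm.
  have speed1 : speed^-1 * speed = 1 by rewrite mulVf // gt_eqF.
  have Vm : (mean_hitting theta N.+1 / N.+1%:R) * (N.+1%:R / (m N.+1)%:R)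
      @[N --> \oo] --> (1 : R).
    rewrite -[X in _ --> X]speed1.
    exact: (cvgM (cvg_mean_hitting theta_outward) Nm).
  rewrite -[X in _ --> X]invr1; apply: cvg_trans (cvgV (oner_neq0 R) Vm).
  apply: near_eq_cvg; near=> N => /=.
  have V0 : mean_hitting theta N.+1 != 0.
    by rewrite gt_eqF // (lt_le_trans ltr01) // mean_hitting_ge1.
  by rewrite /= mulrA divfK // invf_div.
apply: cvg_trans ratio; apply: near_eq_cvg; near=> N.
rewrite /normalized_tau /= (expectation_tau hX) // (tau_m _ _).1 // inver.
rewrite gt_eqF ?EFinM // (lt_le_trans ltr01) // mean_hitting_ge1 //.
Unshelve. all: by end_near. Qed.

End LawOfLargeNumbers.

Unset Implicit Arguments.
Set Strict Implicit.
Local Open Scope ereal_scope.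

Theorem theorem6 (R : realType) (theta : R) (d : measure_display)
    (T : measurableType d) (P : probability T R) (X : nat -> T -> int)
    (hX : markov_chain P (single_well theta) 0%R X) :
  ((0 < theta < 1 / 2)%R ->
     cvg_in_distribution P (normalized_tau P X) (exponential_prob 1%R)) /\
  ((1 / 2 < theta <= 1)%R ->
     {ae P, forall w, normalized_tau P X N w @[N --> \oo] --> 1}).
Proof.
split=> [inward|outward].
- exact: normalized_tau_cvg_exponential hX inward.
- exact: normalized_tau_ae_cvg1 hX outward.
Qed.
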